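(* Let $\alpha\in\mathbb{D}^{\mathbb{Z}}$ be bounded away from $\partial\mathbb{D}$, i.e. $\|\alpha\|_\infty<1$. Suppose that there exist $z_0\in\partial\mathbb{D}$, a constant $c>0$, and a sequence of positive integers $n_k\to\infty$ such that $$\alpha(j) = \alpha(j+n_k),\qquad 0\le j\le n_k-1,$$ and $|\mathrm{tr}(T(n_k,0;z_0))|\le c$ for all $k$. Then $z_0$ is not an eigenvalue of $\mathcal{E}_\alpha$. More precisely, there is a constant $\Delta>0$ that depends only on $c$ and $\|\alpha\|_\infty$ such that $$\max\big(\|\Phi(\underline{n_k})\|,\ \|\Phi(2n_k)\|\big)\ \geq\ \Delta\,\|\Phi(0)\|$$ for all $k$, where $\Phi(n) = (u_n,v_n)^\top$, $u\in\mathbb{C}^{\mathbb{Z}}$ is any solution of $\mathcal{E}_\alpha u = z_0u$, $v=\mathcal{M}u$, and $\underline{n_k} = 2\lfloor n_k/2\rfloor$ denotes the greatest even integer not exceeding $n_k$.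
   Context: $\mathbb{D} = \{z \in \mathbb{C} : |z|<1\}$, $\partial\mathbb{D}$ is the unit circle, and $\alpha(n)=\alpha_n$. Given $\alpha = (\alpha_n)_{n\in\mathbb{Z}}$ with $\alpha_n \in \mathbb{D}$ (the Verblunsky coefficients), the corresponding extended CMV matrix is the unitary operator $\mathcal{E}=\mathcal{E}_\alpha = \mathcal{L}\mathcal{M}$ on $\ell^2(\mathbb{Z})$, where $$\mathcal{L} = \bigoplus_{j\in\mathbb{Z}} \Theta(\alpha_{2j}),\quad \mathcal{M} = \bigoplus_{j\in\mathbb{Z}} \Theta(\alpha_{2j+1}),\quad \Theta(\alpha) = \begin{pmatrix} \overline{\alpha} & \rho \\ \rho & -\alpha\end{pmatrix},\quad \rho = \sqrt{1-|\alpha|^2},$$ and $\Theta(\alpha_n)$ acts on $\ell^2(\{n,n+1\})$. Being banded, $\mathcal{L},\mathcal{M},\mathcal{E}$ also act on all of $\mathbb{C}^{\mathbb{Z}}$. For $\alpha\in\mathbb{D}$, $z\in\partial\mathbb{D}$, the Szegő matrix is $$S(\alpha,z) = \frac{1}{\sqrt{1-|\alpha|^2}}\begin{pmatrix} z & -\overline{\alpha}\\ -\alpha z & 1\end{pmatrix},$$ and the Szegő transfer matrices associated to $\mathcal{E}_\alpha$ are $T(n,m;z) = S(\alpha_{n-1},z)\cdots S(\alpha_m,z)$ for $n>m$, $T(n,n;z)=I$, and $T(n,m;z)=T(m,n;z)^{-1}$ for $n<m$. $\|\cdot\|$ is the Euclidean norm on $\mathbb{C}^2$. *)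

(* Defs.v *)
From HB Require Import structures.
From mathcomp Require Import all_boot all_order all_algebra.
From mathcomp Require Import complex.
From mathcomp Require Import all_classical all_reals all_analysis.

Set Implicit Arguments.
Unset Strict Implicit.
Unset Printing Implicit Defensive.

Import Order.TTheory GRing.Theory Num.Theory.

Local Open Scope classical_set_scope.
Local Open Scope ring_scope.
Local Open Scope complex_scope.

(* The R-valued modulus on R[i]; the norm `|z| of the library takes its values
   in R[i] itself. *)
Definition modulus (R : realType) (z : R[i]) : R := ComplexField.Normc.normc z.

Definition mx22 (T : Type) (a b c d : T) : 'M[T]_2 :=
  \matrix_(i, j) if i == 0 then (if j == 0 then a else b)
                 else (if j == 0 then c else d).

Definition vec2 (T : Type) (a b : T) : 'cV[T]_2 :=
  \col_i if i == 0 then a else b.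

(* The library norm on matrices is the sup norm. *)
Definition norm2 (R : realType) (w : 'cV[R[i]]_2) : R :=
  Num.sqrt (\sum_i modulus (w i 0) ^+ 2).

Definition supnorm (R : realType) (alpha : int -> R[i]) : R :=
  sup (range (fun n => modulus (alpha n))).

Definition ell2 (R : realType) : set (int -> R[i]) :=
  [set u | summable [set: int] (fun n => (modulus (u n) ^+ 2)%:E)].

Section CMV.
Variable R : realType.
Implicit Types (alpha u : int -> R[i]) (z : R[i]) (n m : int).

Definition rho (a : R[i]) : R := Num.sqrt (1 - modulus a ^+ 2).

Definition Theta (a : R[i]) : 'M[R[i]]_2 :=
  mx22 a^* (rho a)%:C
       (rho a)%:C (- a).

Definition oddz n : bool := odd `|n|%N.

(* The direct sum of the 2 x 2 blocks B n over the n such that start n, with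
   B n acting on the coordinates {n, n + 1}; it is meant for predicates start
   that hold at exactly one of any two consecutive integers. *)
Definition block_sum (start : pred int) (B : int -> 'M[R[i]]_2) u
    : int -> R[i] :=
  fun n => if start n
           then (B n *m vec2 (u n) (u (n + 1))) 0 0
           else (B (n - 1) *m vec2 (u (n - 1)) (u n)) 1 0.

Definition opL alpha := block_sum (fun n => ~~ oddz n) (fun n => Theta (alpha n)).

Definition opM alpha := block_sum oddz (fun n => Theta (alpha n)).

Definition extCMV alpha u : int -> R[i] := opL alpha (opM alpha u).

Definition l2_eigenvalue (A : (int -> R[i]) -> (int -> R[i])) z : Prop :=
  exists u, [/\ ell2 u, exists n, u n != 0 & forall n, A u n = z * u n].

Definition szego (a z : R[i]) : 'M[R[i]]_2 :=
  ((rho a)^-1)%:C *: mx22 z (- a^*)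
                          (- a * z) 1.

Fixpoint szego_prod alpha z m (k : nat) : 'M[R[i]]_2 :=
  if k is k'.+1 then szego (alpha (m + k'%:Z)) z *m szego_prod alpha z m k'
  else 1%:M.

Definition transfer alpha n m z : 'M[R[i]]_2 :=
  if m <= n then szego_prod alpha z m `|n - m|%N
  else invmx (szego_prod alpha z n `|m - n|%N).

Definition Phi alpha u n : 'cV[R[i]]_2 := vec2 (u n) (opM alpha u n).

End CMV.

(* Main.v *)
Require Import Defs.
From HB Require Import structures.
From mathcomp Require Import all_boot all_order all_algebra.
From mathcomp Require Import complex.
From mathcomp Require Import all_classical all_reals all_analysis.
From mathcomp Require Import ring lra.

(* Gordon's two-block argument. For a solution [u], the vectors [Phi] evolve, up
   to unimodular factors and an exchange of coordinates at odd sites, by the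
   Szego matrices, so |Phi(n)| = |T(n,0) Phi(0)|. With T = T(n_k,0), periodicity
   gives T(2 n_k,0) = T^2, and Cayley-Hamilton with |det T| = 1 yields
   |Phi(0)| <= |tr T| |T Phi(0)| + |T^2 Phi(0)|. A square-summable solution would
   have Phi(n) -> 0, forcing Phi(0) = 0 and hence u = 0. *)

Set Implicit Arguments.
Unset Strict Implicit.
Unset Printing Implicit Defensive.

Import Order.TTheory GRing.Theory Num.Theory.

Local Open Scope classical_set_scope.
Local Open Scope ring_scope.

(** * Coordinates, determinant and Cayley-Hamilton for 2 x 2 matrices *)

Lemma mulmx_col2 (K : pzRingType) (M : 'M[K]_2) (w : 'cV[K]_2) i :
  (M *m w) i 0 = M i 0 * w 0 0 + M i 1 * w 1 0.
Proof.
rewrite mxE !big_ord_recl big_ord0 addr0.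
by congr (_ + _ * _); congr (_ _ _); apply: val_inj.
Qed.

Lemma ord2P (P : 'I_2 -> Prop) : P 0 -> P 1 -> forall i, P i.
Proof.
move=> P0 P1 [[|[|//]] hi].
- by rewrite (_ : Ordinal hi = 0)//; exact: val_inj.
- by rewrite (_ : Ordinal hi = 1)//; exact: val_inj.
Qed.

Lemma col2P (T : Type) (v w : 'cV[T]_2) :
  v 0 0 = w 0 0 -> v 1 0 = w 1 0 -> v = w.
Proof.
by move=> vw0 vw1; apply/matrixP => i j; rewrite (ord1 j); move: i; exact: ord2P.
Qed.

Lemma det_mx2 (K : comNzRingType) (M : 'M[K]_2) :
  \det M = M 0 0 * M 1 1 - M 0 1 * M 1 0.
Proof.
rewrite (expand_det_row M 0) !big_ord_recl big_ord0 addr0 /cofactor !det_mx11.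
rewrite !mxE /= expr0 mul1r expr1 mulN1r mulrN.
by congr (_ * _ - _ * _); congr (_ _ _); apply: val_inj.
Qed.

Lemma Cayley_Hamilton_col2 (K : comNzRingType) (M : 'M[K]_2) (w : 'cV[K]_2) :
  M *m (M *m w) = \tr M *: (M *m w) - \det M *: w.
Proof.
have trM : \tr M = M 0 0 + M 1 1.
  rewrite /mxtrace !big_ord_recl big_ord0 addr0.
  by congr (_ + _); congr (_ _ _); apply: val_inj.
by apply: col2P; rewrite trM det_mx2 !(mulmx_col2, mxE); ring.
Qed.

(** * The modulus on [R[i]] and the Euclidean norm on pairs *)

Section Modulus.
Variable R : realType.
Implicit Types (a b : R[i]) (u v w : 'cV[R[i]]_2).

Lemma modulus_ge0 a : 0 <= modulus a.
Proof. by case: a => x y; exact: sqrtr_ge0. Qed.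

Lemma modulusM a b : modulus (a * b) = modulus a * modulus b.
Proof. exact: ComplexField.Normc.normcM. Qed.

Lemma modulusN a : modulus (- a) = modulus a.
Proof. by case: a => x y; rewrite /modulus /= !sqrrN. Qed.

Lemma modulusJ a : modulus a^*%C = modulus a.
Proof. by case: a => x y; rewrite /modulus /= sqrrN. Qed.

Lemma modulusV a : modulus a^-1 = (modulus a)^-1.
Proof. exact: ComplexField.Normc.normcV. Qed.

Lemma modulus1 : modulus 1 = 1 :> R.
Proof. exact: ComplexField.Normc.normc1. Qed.

Lemma modulus0 : modulus 0 = 0 :> R.
Proof. exact: ComplexField.Normc.normc0. Qed.

Lemma modulus_real (x : R) : modulus x%:C%C = `|x|.
Proof. by rewrite /modulus /= expr0n addr0 sqrtr_sqr. Qed.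

Lemma modulusD a b : modulus (a + b) <= modulus a + modulus b.
Proof.
rewrite -lecR rmorphD /=.
by have := ler_normD a b; rewrite /Num.norm.
Qed.

Lemma modulus_eq0 a : modulus a = 0 -> a = 0.
Proof. exact: ComplexField.Normc.eq0_normc. Qed.

Lemma modulus1_neq0 a : modulus a = 1 -> a != 0.
Proof. by apply: contra_eq_neq => ->; rewrite modulus0 eq_sym oner_eq0. Qed.

Lemma mulr_conj a : a * a^*%C = ((modulus a ^+ 2)%:C)%C.
Proof.
case: a => x y; rewrite /modulus /= sqr_sqrtr ?addr_ge0 ?sqr_ge0//.
by apply/eqP; rewrite eq_complex /=; apply/andP; split; apply/eqP; ring.
Qed.

Lemma norm2E w :
  norm2 w = Num.sqrt (modulus (w 0 0) ^+ 2 + modulus (w 1 0) ^+ 2).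
Proof.
rewrite /norm2 !big_ord_recl big_ord0 addr0.
by congr (Num.sqrt (_ + modulus (w _ _) ^+ _)); apply: val_inj.
Qed.

Lemma norm2_ge0 w : 0 <= norm2 w.
Proof. exact: sqrtr_ge0. Qed.

Lemma norm2Z a w : norm2 (a *: w) = modulus a * norm2 w.
Proof.
rewrite !norm2E !mxE !modulusM !exprMn -mulrDr sqrtrM ?sqr_ge0//.
by rewrite sqrtr_sqr ger0_norm ?modulus_ge0.
Qed.

(* Minkowski for the plane is the triangle inequality for |w_0| + i |w_1|. *)
Lemma norm2D v w : norm2 (v + w) <= norm2 v + norm2 w.
Proof.
have norm2C u : norm2 u = modulus (modulus (u 0 0) +i* modulus (u 1 0))%C.
  exact: norm2E.
rewrite [X in _ <= X + _]norm2C [X in _ <= _ + X]norm2C.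
apply: le_trans (modulusD _ _); rewrite norm2E.
rewrite /modulus /= -!/(modulus _) ler_wsqrtr//.
by rewrite lerD// ler_pXn2r ?nnegrE ?addr_ge0 ?modulus_ge0// !mxE modulusD.
Qed.

Lemma norm2_eq0 w : norm2 w = 0 -> w = 0.
Proof.
rewrite norm2E => /eqP; rewrite sqrtr_eq0 => ww0.
have [w0 w1] : modulus (w 0 0) = 0 /\ modulus (w 1 0) = 0.
  have := modulus_ge0 (w 0 0); have := modulus_ge0 (w 1 0) => *; split; nra.
by apply: col2P; rewrite mxE; exact: modulus_eq0.
Qed.

Lemma norm2_le_modulusD w : norm2 w <= modulus (w 0 0) + modulus (w 1 0).
Proof.
have := modulus_ge0 (w 0 0); have := modulus_ge0 (w 1 0) => *.
rewrite norm2E -[leRHS]ger0_norm ?addr_ge0// -sqrtr_sqr ler_wsqrtr//; nra.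
Qed.

(** Cauchy-Schwarz against the vector (1, 1), from the nonnegativity of the squared difference of
    the two moduli. *)
Lemma modulusD_le_norm2 w :
  (modulus (w 0 0) + modulus (w 1 0)) ^+ 2 <= 2 * norm2 w ^+ 2.
Proof.
rewrite norm2E sqr_sqrtr ?addr_ge0 ?sqr_ge0//.
by have := sqr_ge0 (modulus (w 0 0) - modulus (w 1 0)); nra.
Qed.

End Modulus.

(** * Szego matrices and the recursion they induce on solutions *)

Section Szego.
Variable R : realType.
Implicit Types (a z : R[i]) (alpha u : int -> R[i]) (n m : int).

Lemma rho_gt0 a : modulus a < 1 -> 0 < rho a.
Proof. by move=> a1; rewrite sqrtr_gt0 subr_gt0 expr_lt1 ?modulus_ge0. Qed.

Lemma rhoC_neq0 a : modulus a < 1 -> (rho a)%:C%C != 0.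
Proof.
move=> /rho_gt0 a1.
by rewrite -(rmorph0 (real_complex R)) (inj_eq (@complexI _)) gt_eqF.
Qed.

Lemma sqr_rhoC a : modulus a < 1 -> ((rho a)%:C%C) ^+ 2 = 1 - a * a^*%C.
Proof.
move=> a1; rewrite mulr_conj -rmorphXn /= sqr_sqrtr ?rmorphB ?rmorph1//.
by rewrite subr_ge0 expr_le1 ?modulus_ge0// ltW.
Qed.

(** With the inverse taken in [R[i]], [field] can treat the embedded [rho a] as one atom. *)
Lemma szegoE a z : szego a z =
  ((rho a)%:C%C)^-1 *: mx22 z (- a^*%C) (- a * z) 1.
Proof. by rewrite /szego fmorphV. Qed.

Lemma det_szego a z : modulus a < 1 -> \det (szego a z) = z.
Proof.
move=> a1; rewrite det_mx2 szegoE !mxE /=.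
have t0 := rhoC_neq0 a1; have := sqr_rhoC a1.
move: t0; set t := ((rho a)%:C)%C => t0 tE.
transitivity (z * (1 - a * a^*%C) / t ^+ 2); first by field.
by rewrite -tE mulfK// expf_neq0.
Qed.

Lemma det_szego_prod alpha z m k : (forall n, modulus (alpha n) < 1) ->
  \det (szego_prod alpha z m k) = z ^+ k.
Proof.
move=> alpha1; elim: k => [|k IHk]; first by rewrite det1.
by rewrite /= det_mulmx IHk det_szego// exprS.
Qed.

(* [Theta a] maps [(x, y)] to [(p, q)], the Szego matrix solves the same
   relations for [(y, q)] in terms of [(x, p)]. *)
Lemma Theta_solve a (x y p q : R[i]) : modulus a < 1 ->
  p = a^*%C * x + (rho a)%:C%C * y -> q = (rho a)%:C%C * x - a * y ->
  y = ((rho a)%:C%C)^-1 * (p - a^*%C * x) /\ q = ((rho a)%:C%C)^-1 * (x - a * p).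
Proof.
move=> a1 -> ->; have t0 := rhoC_neq0 a1; have := sqr_rhoC a1.
move: t0; set t := ((rho a)%:C)%C => t0 tE.
split; first by field.
apply: (mulfI t0); rewrite mulVKf// mulrBr mulrA -expr2 tE; ring.
Qed.

Lemma oddzS n : oddz (n + 1) = ~~ oddz n.
Proof.
case: n => n; first by rewrite -PoszD addn1.
have -> : Negz n + 1 = - n%:Z by rewrite NegzE -addn1 PoszD opprD addrNK.
by rewrite /oddz abszN /= negbK.
Qed.

(* At odd sites the two components have to be interchanged and rescaled for the
   Szego recursion to take one form at all sites. *)
Definition szego_state alpha u z n : 'cV[R[i]]_2 :=
  if oddz n then vec2 (opM alpha u n) (z * u n) else Phi alpha u n.

Lemma norm2_szego_state alpha u z n : modulus z = 1 ->
  norm2 (szego_state alpha u z n) = norm2 (Phi alpha u n).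
Proof.
move=> z1; rewrite /szego_state; case: ifP => // _.
by rewrite !norm2E !mxE /= modulusM z1 mul1r addrC.
Qed.

(** The block starting at [n] belongs to [opM] for odd [n], linking [v] to [u], and to [opL] for
    even [n], linking [z * u] to [v]; [Theta_solve] turns either into a Szego step. The state at an
    odd site carries [z * u n], so the step out of it produces an extra factor [z], which [z^-1]
    removes. *)
Lemma szego_stateS alpha u z n :
  modulus (alpha n) < 1 -> z != 0 -> (forall n, extCMV alpha u n = z * u n) ->
  szego_state alpha u z (n + 1) =
  (if oddz n then z^-1 else 1) *: (szego (alpha n) z *m szego_state alpha u z n).
Proof.
move=> a1 z0 Eu; rewrite /szego_state /Phi oddzS.
have [on|en] /= := boolP (oddz n).
- have vn :
      opM alpha u n = (alpha n)^*%C * u n + (rho (alpha n))%:C%C * u (n + 1).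
    by rewrite /opM /block_sum on mulmx_col2 !mxE.
  have vn1 :
      opM alpha u (n + 1) = (rho (alpha n))%:C%C * u n - alpha n * u (n + 1).
    by rewrite /opM /block_sum oddzS on /= addrK mulmx_col2 !mxE /= mulNr.
  have [un1 vn1'] := Theta_solve a1 vn vn1; have t0 := rhoC_neq0 a1.
  by apply: col2P; rewrite szegoE !(mulmx_col2, mxE) /= ?un1 ?vn1'; field;
    rewrite z0 t0.
- set v := opM alpha u in Eu *.
  have un : z * u n = (alpha n)^*%C * v n + (rho (alpha n))%:C%C * v (n + 1).
    by rewrite -Eu /extCMV /opL /block_sum en mulmx_col2 !mxE.
  have un1 : z * u (n + 1) = (rho (alpha n))%:C%C * v n - alpha n * v (n + 1).
    rewrite -Eu /extCMV /opL /block_sum oddzS en /= addrK.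
    by rewrite mulmx_col2 !mxE /= mulNr.
  have [vn1 un1'] := Theta_solve a1 un un1; have t0 := rhoC_neq0 a1.
  by apply: col2P; rewrite szegoE !(mulmx_col2, mxE) /= ?vn1 ?un1'; field.
Qed.

End Szego.

(** * Norm estimates along the Szego recursion and the two-block bound *)

Section Bounds.
Variable R : realType.
Implicit Types (z : R[i]) (alpha u : int -> R[i]).

(** Without its scalar factor the matrix has entries of modulus at most 1, so each coordinate of the
    image is at most [s], the sum of the moduli of [w]. The squared norm is then at most
    [2 * s ^+ 2], hence at most 4 times that of [w]. *)
Lemma norm2_szego (a z : R[i]) (r : R) (w : 'cV[R[i]]_2) :
  modulus a <= r -> r < 1 -> modulus z = 1 ->
  norm2 (szego a z *m w) <= 2 / Num.sqrt (1 - r ^+ 2) * norm2 w.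
Proof.
move=> ar r1 z1; have r0 : 0 <= r := le_trans (modulus_ge0 a) ar.
have a1 : modulus a <= 1 by rewrite (le_trans ar)// ltW.
have s0 : 0 < Num.sqrt (1 - r ^+ 2) by rewrite sqrtr_gt0 subr_gt0 expr_lt1.
have srho : Num.sqrt (1 - r ^+ 2) <= rho a.
  by rewrite ler_wsqrtr// lerB// ler_pXn2r ?nnegrE ?modulus_ge0.
have rho0 : 0 < rho a by exact: lt_le_trans srho.
rewrite /szego -scalemxAl norm2Z modulus_real gtr0_norm ?invr_gt0//.
rewrite [2 / _]mulrC -mulrA.
rewrite ler_pM ?norm2_ge0 ?lef_pV2 ?posrE ?invr_ge0 ?(ltW rho0)//.
set S := (X in X *m w); pose s := modulus (w 0 0) + modulus (w 1 0).
have entry i : modulus ((S *m w) i 0) <= s.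
  have entry2 (x y : R[i]) : modulus x <= 1 -> modulus y <= 1 ->
      modulus (x * w 0 0 + y * w 1 0) <= s.
    move=> x1 y1; apply: le_trans (modulusD _ _) _.
    by rewrite !modulusM lerD// ler_piMl ?modulus_ge0.
  rewrite mulmx_col2; move: i.
  by apply: ord2P; rewrite !mxE /=; apply: entry2;
     rewrite ?modulusM ?modulusN ?modulusJ ?modulus1 ?z1 ?mulr1.
rewrite -(@ler_pXn2r _ 2)// ?nnegrE ?mulr_ge0 ?norm2_ge0//.
rewrite [X in X ^+ 2 <= _]norm2E sqr_sqrtr ?addr_ge0 ?sqr_ge0//.
have e0 := entry 0; have e1 := entry 1; have := modulusD_le_norm2 w.
have p0 := modulus_ge0 ((S *m w) 0 0); have p1 := modulus_ge0 ((S *m w) 1 0).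
by rewrite -/s; nra.
Qed.

Lemma modulus_le_supnorm alpha n :
  (forall n, modulus (alpha n) < 1) -> modulus (alpha n) <= supnorm alpha.
Proof.
move=> alpha1; apply: ub_le_sup; last by exists n.
by exists 1 => _ [m _ <-]; exact: ltW.
Qed.

Lemma szego_prodD alpha z (m : int) (j k : nat) :
  szego_prod alpha z m (k + j) =
  szego_prod alpha z (m + j%:Z) k *m szego_prod alpha z m j.
Proof.
elim: k => [|k IHk]; first by rewrite mul1mx.
by rewrite addSn /= IHk mulmxA PoszD addrA addrAC.
Qed.

Lemma eq_szego_prod alpha z (m m' : int) (k : nat) :
  (forall j : nat, (j < k)%N -> alpha (m + j%:Z) = alpha (m' + j%:Z)) ->
  szego_prod alpha z m k = szego_prod alpha z m' k.
Proof.
elim: k => //= k IHk eq_alpha; rewrite eq_alpha// IHk// => j jk.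
by apply: eq_alpha; exact: ltnW.
Qed.

Lemma norm2_Phi_szego_prod alpha u z (n : nat) :
  (forall n, modulus (alpha n) < 1) -> modulus z = 1 ->
  (forall n, extCMV alpha u n = z * u n) ->
  norm2 (Phi alpha u n%:Z) = norm2 (szego_prod alpha z 0 n *m Phi alpha u 0).
Proof.
move=> alpha1 z1 Eu.
have z0 := modulus1_neq0 z1.
rewrite -(norm2_szego_state _ _ _ z1).
(* The unimodular factors of the single steps accumulate in [c]; at site 0, which is even, the state
   is [Phi] itself. *)
suff [c c1 ->] : exists2 c, modulus c = 1 & szego_state alpha u z n%:Z =
    c *: (szego_prod alpha z 0 n *m Phi alpha u 0).
  by rewrite norm2Z c1 mul1r.
elim: n => [|n [c c1 IHn]].
  by exists 1; rewrite ?modulus1// mul1mx scale1r.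
rewrite intS addrC szego_stateS// IHn /= add0r -scalemxAr scalerA mulmxA.
eexists; last by [].
by rewrite modulusM c1 mulr1; case: ifP; rewrite ?modulusV ?z1 ?invr1 ?modulus1.
Qed.

(** The Szego matrix has determinant [z], hence is invertible, so vanishing propagates in both
    directions. *)
Lemma szego_state_eq0S alpha u z n :
  (forall n, modulus (alpha n) < 1) -> z != 0 ->
  (forall n, extCMV alpha u n = z * u n) ->
  szego_state alpha u z (n + 1) = 0 <-> szego_state alpha u z n = 0.
Proof.
move=> alpha1 z0 Eu; rewrite szego_stateS//.
set c := (if _ then _ else _).
have c0 : c != 0 by rewrite /c; case: ifP; rewrite ?invr_eq0 ?oner_eq0.
split=> [/eqP|->]; last by rewrite mulmx0 scaler0.
rewrite scaler_eq0 (negbTE c0) => /eqP Sw0.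
by rewrite -[LHS](@mulKmx _ _ _ (szego (alpha n) z)) ?Sw0 ?mulmx0//
  unitmxE unitfE det_szego.
Qed.

Lemma Phi0_neq0 alpha u z :
  (forall n, modulus (alpha n) < 1) -> modulus z = 1 ->
  (forall n, extCMV alpha u n = z * u n) -> (exists n, u n != 0) ->
  Phi alpha u 0 != 0.
Proof.
move=> alpha1 z1 Eu [n un0]; apply: contra_neq un0 => Phi0.
have z0 := modulus1_neq0 z1.
have stepP m := szego_state_eq0S m alpha1 z0 Eu.
have : szego_state alpha u z n = 0.
  case: n => n.
    elim: n => [//|n IHn].
    by rewrite intS addrC; apply/stepP.
  rewrite NegzE; elim: n.+1 => [//|{}n IHn].
  by apply/stepP; rewrite intS opprD addrC addrA subrr add0r.
have ev0 (v : 'cV[R[i]]_2) i : v = 0 -> v i 0 = 0 by move=> ->; rewrite mxE.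
(* The value of [u] at [n] sits in the second coordinate, times [z], at odd sites and in the first
   at even ones. *)
rewrite /szego_state; case: ifP => _ => [/(ev0 _ 1)|/(ev0 _ 0)]; rewrite mxE//=.
by move/eqP; rewrite mulf_eq0 (negbTE z0) => /eqP.
Qed.

(* For odd [n] one Szego step, of norm at most [2 / sqrt (1 - r^2)], leads from
   the even site [n - 1] to [T x]. *)
Lemma Gordon_bound alpha u z (r c : R) (n : nat) :
  (forall n, modulus (alpha n) <= r) -> r < 1 -> modulus z = 1 ->
  (forall j : nat, (j < n)%N -> alpha j%:Z = alpha (j%:Z + n%:Z)) ->
  modulus (\tr (transfer alpha n%:Z 0 z)) <= c ->
  (forall n, extCMV alpha u n = z * u n) ->
  norm2 (Phi alpha u 0) <= (1 + c * (2 / Num.sqrt (1 - r ^+ 2))) *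
    Num.max (norm2 (Phi alpha u (n./2.*2)%:Z)) (norm2 (Phi alpha u (2 * n)%:Z)).
Proof.
move=> alphar r1 z1 per trc Eu; set m := Num.max _ _.
set K := 2 / _.
have alpha1 k : modulus (alpha k) < 1 by exact: le_lt_trans (alphar k) r1.
have r0 : 0 <= r := le_trans (modulus_ge0 _) (alphar 0).
have s0 : 0 < Num.sqrt (1 - r ^+ 2) by rewrite sqrtr_gt0 subr_gt0 expr_lt1.
(* This lets the bound [K * m] on [T *m x] also cover even [n], where [m] alone suffices. *)
have K1 : 1 <= K.
  rewrite ler_pdivlMr// mul1r -[2]ger0_norm// -sqrtr_sqr ler_wsqrtr//.
  by have := sqr_ge0 r; lra.
move: trc; rewrite /transfer /= addn0.
set T := szego_prod alpha z 0 n; set x := Phi alpha u 0 => trc.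
have m0 : 0 <= m by rewrite le_max norm2_ge0.
have TTx : norm2 (T *m (T *m x)) <= m.
  (* The product over two periods splits at [n], and periodicity identifies its second half with
     [T]. *)
  rewrite mulmxA -[X in X *m _](_ : szego_prod alpha z 0 (n + n) = _); last first.
    rewrite szego_prodD add0r -/T; congr (_ *m _); apply: eq_szego_prod => j jn.
    by rewrite add0r [n%:Z + _]addrC -per.
  by rewrite -norm2_Phi_szego_prod// addnn -mul2n le_max lexx orbT.
have Tx : norm2 (T *m x) <= K * m.
  have [on|en] := boolP (odd n).
    have nE : n = (n./2.*2).+1 by rewrite -{1}[n]odd_double_half on.
    rewrite /T nE /= -mulmxA; apply: le_trans (norm2_szego _ (alphar _) r1 z1) _.
    rewrite -norm2_Phi_szego_prod// ler_wpM2l ?(le_trans _ K1)//.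
    by rewrite le_max lexx.
  rewrite -norm2_Phi_szego_prod//; apply: (@le_trans _ _ m); last first.
    by rewrite ler_peMl.
  by rewrite /m even_halfK// le_max lexx.
(* Cayley-Hamilton solved for the determinant term, where [\det T] is [z ^+ n], of modulus 1. *)
have xE : z ^+ n *: x = \tr T *: (T *m x) + (-1) *: (T *m (T *m x)).
  by rewrite Cayley_Hamilton_col2 det_szego_prod// scaleN1r opprB addrC subrK.
have zn1 : modulus (z ^+ n) = 1.
  by elim: (n) => [|k IHk]; rewrite ?modulus1// exprS modulusM IHk z1 mulr1.
have -> : norm2 x = norm2 (z ^+ n *: x) by rewrite norm2Z zn1 mul1r.
rewrite xE; apply: le_trans (norm2D _ _) _.
rewrite !norm2Z modulusN modulus1 mul1r addrC mulrDl mul1r lerD// -mulrA.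
by rewrite ler_pM ?modulus_ge0 ?norm2_ge0.
Qed.

(** * Decay of square-summable sequences and of [Phi] along them *)

Lemma ell2_cvg0 u : ell2 u -> forall e, 0 < e ->
  exists N : nat, forall n : nat, (N <= n)%N -> modulus (u n%:Z) < e.
Proof.
move=> u2 e e0; pose f (n : nat) : \bar R := (modulus (u n%:Z) ^+ 2)%:E.
have f0 n : (0 <= f n)%E by rewrite lee_fin sqr_ge0.
have sf : summable (xpredT : pred nat) f.
  apply: le_lt_trans u2.
  (* The sum over the integers splits into nonnegative and negative indices; the negative part is
     nonnegative and is dropped. *)
  rewrite (esumID (range Posz))//= setTI (esum_image setT Posz); last first.
    by move=> i j _ _ [].
  rewrite [X in (esum X _ <= _)%E](_ : _ = setT); last by apply/seteqP; split.
  by rewrite leeDl// esum_ge0.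
have /cvg_series_cvg_0 := @summable_cvg R xpredT f (fun n _ => f0 n) sf.
move=> /cvgr0_norm_lt /(_ _ (exprn_gt0 2 e0)) [N _ uN].
exists N => n /uN; rewrite /= ger0_norm ?sqr_ge0//.
by rewrite ltr_pXn2r ?nnegrE ?modulus_ge0// ltW.
Qed.

Lemma norm2_Phi_cvg0 alpha u :
  (forall n, modulus (alpha n) < 1) -> ell2 u -> forall e, 0 < e ->
  exists N : nat, forall n : nat, (N <= n)%N -> norm2 (Phi alpha u n%:Z) < e.
Proof.
move=> alpha1 u2 e e0.
(* Four terms share [e]: the modulus of [u] at the site itself, and the values of [u] at the site
   and its two neighbours, which bound [opM] there for either parity. *)
have e4 : 0 < e / 4 by rewrite divr_gt0.
(* Starting at [N.+1] keeps the left neighbour in the range where [u] is small. *)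
have [N uN] := ell2_cvg0 u2 e4; exists N.+1 => -[//|n] Nn.
apply: le_lt_trans (norm2_le_modulusD _) _; rewrite !mxE /=.
have rho1 k : `|rho (alpha k)| <= 1.
  rewrite ger0_norm ?sqrtr_ge0// -[leRHS]sqrtr1 ler_wsqrtr//.
  by rewrite gerBl sqr_ge0.
have combine (a b x y : R[i]) : modulus a <= 1 -> modulus b <= 1 ->
    modulus (a * x + b * y) <= modulus x + modulus y.
  move=> a1 b1; apply: le_trans (modulusD _ _) _.
  by rewrite !modulusM lerD// ler_piMl ?modulus_ge0.
have un0 := uN n Nn; have un1 := uN n.+1 (leqW Nn).
have un2 := uN n.+2 (leqW (leqW Nn)).
have vn : modulus (opM alpha u n.+1%:Z) <= modulus (u n%:Z) +
    modulus (u n.+1%:Z) + modulus (u n.+2%:Z).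
  rewrite /opM /block_sum; case: ifP => _; rewrite mulmx_col2 !mxE /=.
    apply: le_trans (combine _ _ _ _ _ _) _.
    - by rewrite modulusJ ltW.
    - by rewrite modulus_real.
    - by rewrite -PoszD addn1 -addrA lerDr modulus_ge0.
  apply: le_trans (combine _ _ _ _ _ _) _.
  - by rewrite modulus_real.
  - by rewrite modulusN ltW.
  - by rewrite [X in u X](_ : _ = n%:Z) ?lerDl ?modulus_ge0// intS addrC addKr.
lra.
Qed.

End Bounds.

Theorem theorem1p3 (R : realType) :
  exists Delta : R -> R -> R,
    (forall c a : R, 0 < c -> 0 <= a < 1 -> 0 < Delta c a) /\
    forall (alpha : int -> R[i]) (z0 : R[i]) (c : R) (n_ : nat -> nat),
      (forall n : int, modulus (alpha n) < 1) ->
      supnorm alpha < 1 ->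
      modulus z0 = 1 ->
      0 < c ->
      (forall k : nat, (0 < n_ k)%N) ->
      n_ k @[k --> \oo] --> \oo ->
      (forall (k : nat) (j : int), 0 <= j <= (n_ k)%:Z - 1 ->
         alpha j = alpha (j + (n_ k)%:Z)) ->
      (forall k : nat, modulus (\tr (transfer alpha (n_ k)%:Z 0 z0)) <= c) ->
      ~ l2_eigenvalue (extCMV alpha) z0 /\
      forall u : int -> R[i],
        (forall n : int, extCMV alpha u n = z0 * u n) ->
        forall k : nat,
          Num.max (norm2 (Phi alpha u ((n_ k)./2.*2)%:Z))
                  (norm2 (Phi alpha u (2 * n_ k)%:Z))
          >= Delta c (supnorm alpha) * norm2 (Phi alpha u 0).

Proof.
(* The reciprocal of the constant in [Gordon_bound], with [r] standing for the sup norm of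
   [alpha]. *)
exists (fun c r => (1 + c * (2 / Num.sqrt (1 - r ^+ 2)))^-1).
have den_gt0 (c r : R) : 0 < c -> 0 < 1 + c * (2 / Num.sqrt (1 - r ^+ 2)).
  by move=> c0; rewrite ltr_wpDr// mulr_ge0 ?divr_ge0 ?sqrtr_ge0// ltW.
split=> [c r c0 _|alpha z0 c n_ alpha1 r1 z1 c0 n0 noo per trc].
  by rewrite invr_gt0; exact: den_gt0.
have bound u : (forall n, extCMV alpha u n = z0 * u n) -> forall k,
    (1 + c * (2 / Num.sqrt (1 - supnorm alpha ^+ 2)))^-1 *
      norm2 (Phi alpha u 0) <=
    Num.max (norm2 (Phi alpha u ((n_ k)./2.*2)%:Z))
            (norm2 (Phi alpha u (2 * n_ k)%:Z)).
  move=> Eu k; rewrite mulrC ler_pdivrMr; last exact: den_gt0.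
  rewrite mulrC; apply: (Gordon_bound _ r1 z1) => // [m|j jn].
    exact: modulus_le_supnorm.
  by apply: per; rewrite /= lerBrDr -PoszD addn1.
split=> // -[u [u2 unz Eu]].
have Phi0 : 0 < norm2 (Phi alpha u 0).
  rewrite lt_def norm2_ge0 andbT.
  by apply: contra_neq (Phi0_neq0 alpha1 z1 Eu unz); exact: norm2_eq0.
set D := _^-1 in bound.
have Dpos : 0 < D by rewrite invr_gt0; exact: den_gt0.
(* Past [N] the norm of [Phi] drops below the lower bound that [bound] imposes on the maximum. *)
have [N PhiN] := norm2_Phi_cvg0 alpha1 u2 (mulr_gt0 Dpos Phi0).
(* Rounding [n_ k] down to an even integer loses at most 1, so [N.+1] is required of [n_ k] for both
   sites to lie past [N]. *)
have [k _ /(_ k (leqnn k)) /= Nk] := noo _ (nbhs_infty_ge N.+1).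
have := bound u Eu k; rewrite leNgt gt_max !PhiN//.
  by rewrite mul2n -addnn (leq_trans (ltnW Nk))// leq_addr.
rewrite -ltnS (leq_trans Nk)// -{1}[n_ k]odd_double_half -addn1 addnC leq_add2l.
by case: odd.
Qed.
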